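(* Let $\mathcal{C}$ be a unitary fusion category and let $c$ be a braiding on (the underlying fusion category of) $\mathcal{C}$, with components $c_{X,Y}: X\otimes Y\to Y\otimes X$. Then $c$ is a unitary braiding: for every pair of objects $X,Y\in\mathcal{C}$ the morphism $c_{X,Y}$ is unitary, i.e. $c_{X,Y}\,c_{X,Y}^*=\mathrm{id}_{Y\otimes X}$ and $c_{X,Y}^*\,c_{X,Y}=\mathrm{id}_{X\otimes Y}$.
   Context: Fusion categories are over $\mathbb{C}$: semisimple rigid $\mathbb{C}$-linear abelian monoidal categories with bilinear tensor product, finitely many isomorphism classes of simple objects, finite-dimensional Hom-spaces, and simple unit object. A braiding is a natural isomorphism $c_{X,Y}:X\otimes Y\to Y\otimes X$ satisfying the hexagon axioms; no compatibility with any $*$-structure is assumed. A $C^*$-category is a $\mathbb{C}$-linear abelian category with an involutive antilinear contravariant endofunctor $*$ that is the identity on objects (the image of $f:X\to Y$ is written $f^*:Y\to X$), whose Hom-spaces are Banach spaces with norms satisfying $\|fg\|\le\|f\|\,\|g\|$ for all composable $f,g$ and $\|f^*f\|=\|f\|^2$ for all morphisms $f$, and such that for each $f:X\to Y$ the element $f^*f$ is positive in the $C^*$-algebra $\mathrm{End}(X)$. A morphism $u:X\to Y$ in a $C^*$-category is unitary if $uu^*=\mathrm{id}_Y$ and $u^*u=\mathrm{id}_X$. A unitary fusion category is a fusion category $\mathcal{C}$ whose underlying category is a $C^*$-category, such that the associativity and unit constraints are unitary and $(f\otimes g)^*=f^*\otimes g^*$ for all morphisms $f,g$ of $\mathcal{C}$.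 *)

(* Defs.v *)
(* The complex numbers are R[i] for R : realType;
   composition is written in the usual order, g ∘ f = "g after f". *)
From HB Require Import structures.
From mathcomp Require Import all_boot all_order all_algebra.
From mathcomp Require Import all_classical all_reals topology normedtype.
From mathcomp Require Import complex.

Set Implicit Arguments.
Unset Strict Implicit.
Unset Printing Implicit Defensive.

Import Order.TTheory GRing.Theory Num.Theory.
Import numFieldNormedType.Exports.

Local Open Scope classical_set_scope.
Local Open Scope ring_scope.

Reserved Notation "g ∘ f" (at level 40, left associativity).
Reserved Notation "X ⊗ Y" (at level 39, left associativity).
Reserved Notation "f ⊠ g" (at level 39, left associativity).
Reserved Notation "f ^†" (at level 1, format "f ^†").

(* Stated for raw data so that a category whose Hom-spaces carry more structure
   than that of a vector space can share these axioms. *)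
Record linear_category_axioms (R : realType) (obj : Type)
    (mor : obj -> obj -> lmodType R[i]) (idm : forall X, mor X X)
    (mcomp : forall X Y Z, mor Y Z -> mor X Y -> mor X Z) : Prop :=
  LinearCategoryAxioms {
  compA_ax : forall W X Y Z (h : mor Y Z) (g : mor X Y) (f : mor W X),
    mcomp _ _ _ h (mcomp _ _ _ g f) = mcomp _ _ _ (mcomp _ _ _ h g) f;
  comp1m_ax : forall X Y (f : mor X Y), mcomp _ _ _ (idm Y) f = f;
  compm1_ax : forall X Y (f : mor X Y), mcomp _ _ _ f (idm X) = f;
  comp_linearl_ax : forall X Y Z (f : mor X Y),
    linear (fun g : mor Y Z => mcomp _ _ _ g f);
  comp_linearr_ax : forall X Y Z (g : mor Y Z),
    linear (fun f : mor X Y => mcomp _ _ _ g f) }.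

Record linCategory (R : realType) := LinCategory {
  obj :> Type;
  mor : obj -> obj -> lmodType R[i];
  idm : forall X, mor X X;
  mcomp : forall X Y Z, mor Y Z -> mor X Y -> mor X Z;
  linCategoryP : linear_category_axioms idm mcomp }.

Arguments mor {R} C X Y : rename.
Arguments idm {R C} X : rename.
Arguments mcomp {R C X Y Z} g f : rename.

Notation "g ∘ f" := (mcomp g f) : ring_scope.

Section LinearCategories.
Variables (R : realType) (C : linCategory R).
Implicit Types X Y Z S T K : C.

Record iso X Y := Iso {
  fwd : mor C X Y;
  bwd : mor C Y X;
  fwdK : bwd ∘ fwd = idm X;
  bwdK : fwd ∘ bwd = idm Y }.

Definition is_iso X Y (f : mor C X Y) : Prop :=
  exists g : mor C Y X, g ∘ f = idm X /\ f ∘ g = idm Y.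

Definition isomorphic X Y : Prop := exists f : mor C X Y, is_iso f.

Definition mono X Y (f : mor C X Y) : Prop :=
  forall T (g h : mor C T X), f ∘ g = f ∘ h -> g = h.

Definition epi X Y (f : mor C X Y) : Prop :=
  forall T (g h : mor C Y T), g ∘ f = h ∘ f -> g = h.

(* Initial and terminal; existence of maps is automatic. *)
Definition zero_object Z : Prop :=
  forall X, (forall f g : mor C Z X, f = g) /\ (forall f g : mor C X Z, f = g).

Definition is_kernel X Y (f : mor C X Y) K (k : mor C K X) : Prop :=
  f ∘ k = 0 /\
  forall T (g : mor C T X), f ∘ g = 0 -> exists! h : mor C T K, k ∘ h = g.

Definition is_cokernel X Y (f : mor C X Y) K (q : mor C Y K) : Prop :=
  q ∘ f = 0 /\
  forall T (g : mor C Y T), g ∘ f = 0 -> exists! h : mor C K T, h ∘ q = g.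

Definition is_direct_sum n (S : 'I_n -> C) X
    (inj : forall k, mor C (S k) X) (proj : forall k, mor C X (S k)) : Prop :=
  [/\ forall k, proj k ∘ inj k = idm (S k),
      forall k l, k <> l -> proj k ∘ inj l = 0
    & \sum_(k < n) (inj k ∘ proj k) = idm X].

Definition direct_sum_of n (S : 'I_n -> C) X : Prop :=
  exists (inj : forall k, mor C (S k) X) (proj : forall k, mor C X (S k)),
    is_direct_sum inj proj.

(* The case n = 0 of the first field provides a zero object. *)
Record abelian : Prop := Abelian {
  abelian_sum : forall n (S : 'I_n -> C), exists X, direct_sum_of S X;
  abelian_ker : forall X Y (f : mor C X Y),
    exists K (k : mor C K X), is_kernel f k;
  abelian_coker : forall X Y (f : mor C X Y),
    exists K (q : mor C Y K), is_cokernel f q;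
  abelian_mono : forall X Y (f : mor C X Y), mono f ->
    exists Z (g : mor C Y Z), is_kernel g f;
  abelian_epi : forall X Y (f : mor C X Y), epi f ->
    exists Z (g : mor C Z X), is_cokernel g f }.

Definition simple_object X : Prop :=
  ~ zero_object X /\
  forall S (i : mor C S X), mono i -> zero_object S \/ is_iso i.

Definition semisimple : Prop :=
  forall X, exists n (S : 'I_n -> C),
    (forall k, simple_object (S k)) /\ direct_sum_of S X.

Definition finitely_many_simples : Prop :=
  exists n (S : 'I_n -> C),
    forall X, simple_object X -> exists k, isomorphic X (S k).

Definition finite_dimensional_homs : Prop :=
  forall X Y, exists n (e : 'I_n -> mor C X Y),
    forall f, exists a : 'I_n -> R[i], f = \sum_(k < n) a k *: e k.

Definition spectrum X (a : mor C X X) : set R[i] :=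
  [set l | ~ is_iso (a - l *: idm X)].

End LinearCategories.

Record monoidalData (R : realType) (C : linCategory R) := MonoidalData {
  tensO : C -> C -> C;
  tensM : forall W X Y Z, mor C W X -> mor C Y Z ->
    mor C (tensO W Y) (tensO X Z);
  tunit : C;
  assoc_iso : forall X Y Z, iso (tensO (tensO X Y) Z) (tensO X (tensO Y Z));
  lunit_iso : forall X, iso (tensO tunit X) X;
  runit_iso : forall X, iso (tensO X tunit) X }.

Arguments tensO {R C} M X Y : rename.
Arguments tensM {R C} M {W X Y Z} f g : rename.
Arguments tunit {R C} M : rename.
Arguments assoc_iso {R C} M X Y Z : rename.
Arguments lunit_iso {R C} M X : rename.
Arguments runit_iso {R C} M X : rename.

Definition assoc (R : realType) (C : linCategory R) (M : monoidalData C)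
    (X Y Z : C) : mor C (tensO M (tensO M X Y) Z) (tensO M X (tensO M Y Z)) :=
  fwd (assoc_iso M X Y Z).

Definition assocV (R : realType) (C : linCategory R) (M : monoidalData C)
    (X Y Z : C) : mor C (tensO M X (tensO M Y Z)) (tensO M (tensO M X Y) Z) :=
  bwd (assoc_iso M X Y Z).

Definition lunit (R : realType) (C : linCategory R) (M : monoidalData C)
    (X : C) : mor C (tensO M (tunit M) X) X := fwd (lunit_iso M X).

Definition lunitV (R : realType) (C : linCategory R) (M : monoidalData C)
    (X : C) : mor C X (tensO M (tunit M) X) := bwd (lunit_iso M X).

Definition runit (R : realType) (C : linCategory R) (M : monoidalData C)
    (X : C) : mor C (tensO M X (tunit M)) X := fwd (runit_iso M X).

Definition runitV (R : realType) (C : linCategory R) (M : monoidalData C)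
    (X : C) : mor C X (tensO M X (tunit M)) := bwd (runit_iso M X).

Section MonoidalAxioms.
Variables (R : realType) (C : linCategory R) (M : monoidalData C).
Local Notation "X ⊗ Y" := (tensO M X Y).
Local Notation "f ⊠ g" := (tensM M f g).

Record monoidal_axioms : Prop := MonoidalAxioms {
  tensM_id : forall X Y : C, idm X ⊠ idm Y = idm (X ⊗ Y);
  tensM_comp : forall (X X' X'' Y Y' Y'' : C)
    (f' : mor C X' X'') (f : mor C X X') (g' : mor C Y' Y'') (g : mor C Y Y'),
    (f' ∘ f) ⊠ (g' ∘ g) = (f' ⊠ g') ∘ (f ⊠ g);
  tensM_linearl : forall (W X Y Z : C) (g : mor C Y Z),
    linear (fun f : mor C W X => f ⊠ g);
  tensM_linearr : forall (W X Y Z : C) (f : mor C W X),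
    linear (fun g : mor C Y Z => f ⊠ g);
  assoc_natural : forall (X X' Y Y' Z Z' : C)
    (f : mor C X X') (g : mor C Y Y') (h : mor C Z Z'),
    assoc M X' Y' Z' ∘ ((f ⊠ g) ⊠ h) = (f ⊠ (g ⊠ h)) ∘ assoc M X Y Z;
  lunit_natural : forall (X X' : C) (f : mor C X X'),
    lunit M X' ∘ (idm (tunit M) ⊠ f) = f ∘ lunit M X;
  runit_natural : forall (X X' : C) (f : mor C X X'),
    runit M X' ∘ (f ⊠ idm (tunit M)) = f ∘ runit M X;
  pentagon : forall W X Y Z : C,
    assoc M W X (Y ⊗ Z) ∘ assoc M (W ⊗ X) Y Z =
    (idm W ⊠ assoc M X Y Z) ∘ assoc M W (X ⊗ Y) Z ∘ (assoc M W X Y ⊠ idm Z);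
  triangle : forall X Y : C,
    (idm X ⊠ lunit M Y) ∘ assoc M X (tunit M) Y = runit M X ⊠ idm Y }.

End MonoidalAxioms.

Record monoidal (R : realType) (C : linCategory R) := Monoidal {
  monoidal_data :> monoidalData C;
  monoidalP : monoidal_axioms monoidal_data }.

Section MonoidalCategories.
Variables (R : realType) (C : linCategory R) (M : monoidal C).
Local Notation "X ⊗ Y" := (tensO M X Y).
Local Notation "f ⊠ g" := (tensM M f g).

(* D is a left dual of X, equivalently X is a right dual of D. *)
Definition is_left_dual (D X : C) : Prop :=
  exists (ev : mor C (D ⊗ X) (tunit M)) (coev : mor C (tunit M) (X ⊗ D)),
    runit M X ∘ (idm X ⊠ ev) ∘ assoc M X D X ∘ (coev ⊠ idm X) ∘ lunitV M X
      = idm X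
    /\
    lunit M D ∘ (ev ⊠ idm D) ∘ assocV M D X D ∘ (idm D ⊠ coev) ∘ runitV M D
      = idm D.

Definition rigid : Prop :=
  forall X : C, (exists D, is_left_dual D X) /\ (exists D, is_left_dual X D).

Record fusion : Prop := Fusion {
  fusion_abelian : abelian C;
  fusion_semisimple : semisimple C;
  fusion_rigid : rigid;
  fusion_simples : finitely_many_simples C;
  fusion_homs : finite_dimensional_homs C;
  fusion_unit : simple_object (tunit M) }.

Record braiding := Braiding {
  braid_iso : forall X Y : C, iso (X ⊗ Y) (Y ⊗ X);
  braid := fun X Y : C => fwd (braid_iso X Y);
  braid_natural : forall (X X' Y Y' : C) (f : mor C X X') (g : mor C Y Y'),
    braid X' Y' ∘ (f ⊠ g) = (g ⊠ f) ∘ braid X Y;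
  braid_hexagon1 : forall X Y Z : C,
    assoc M Y Z X ∘ braid X (Y ⊗ Z) ∘ assoc M X Y Z =
    (idm Y ⊠ braid X Z) ∘ assoc M Y X Z ∘ (braid X Y ⊠ idm Z);
  braid_hexagon2 : forall X Y Z : C,
    assocV M Z X Y ∘ braid (X ⊗ Y) Z ∘ assocV M X Y Z =
    (braid X Z ⊠ idm Y) ∘ assocV M X Z Y ∘ (idm X ⊠ braid Y Z) }.

End MonoidalCategories.

Record starStructure (R : realType) (C : linCategory R) := StarStructure {
  star : forall X Y : C, mor C X Y -> mor C Y X;
  star_antilinear : forall (X Y : C) (a : R[i]) (f g : mor C X Y),
    star (a *: f + g) = a^* *: star f + star g;
  star_id : forall X : C, star (idm X) = idm X;
  star_comp : forall (X Y Z : C) (g : mor C Y Z) (f : mor C X Y),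
    star (g ∘ f) = star f ∘ star g;
  starK : forall (X Y : C) (f : mor C X Y), star (star f) = f }.

Arguments star {R C} s {X Y} f : rename.

Section StarCategories.
Variables (R : realType) (C : linCategory R) (s : starStructure C).
Local Notation "f ^†" := (star s f).

Definition unitary (X Y : C) (u : mor C X Y) : Prop :=
  u ∘ u^† = idm Y /\ u^† ∘ u = idm X.

(* Hermitian with nonnegative spectrum; in R[i], 0 <= l means that l is a
   nonnegative real number. *)
Definition positive (X : C) (a : mor C X X) : Prop :=
  a^† = a /\ spectrum a `<=` [set l | 0 <= l].

End StarCategories.

Record banachCategory (R : realType) := BanachCategory {
  bobj : Type;
  bhom : bobj -> bobj -> completeNormedModType R[i];
  bidm : forall X, bhom X X;
  bcomp : forall X Y Z, bhom Y Z -> bhom X Y -> bhom X Z;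
  banachCategoryP : @linear_category_axioms R bobj bhom bidm bcomp }.

Arguments bhom {R} C X Y : rename.

Coercion linCategory_of_banach (R : realType) (C : banachCategory R) :
  linCategory R := LinCategory (banachCategoryP C).

(* The norm of a normedModType over R[i] is R[i]-valued; its values are
   nonnegative reals. *)
Definition hnorm (R : realType) (C : banachCategory R) (X Y : C)
  (f : mor C X Y) : R[i] := `|f : bhom C X Y|.

Record cstarCategory (R : realType) := CstarCategory {
  cstar_banach :> banachCategory R;
  cstar_star : starStructure cstar_banach;
  cstar_abelian : abelian cstar_banach;
  hnorm_comp : forall (X Y Z : cstar_banach)
    (g : mor cstar_banach Y Z) (f : mor cstar_banach X Y),
    hnorm (g ∘ f) <= hnorm g * hnorm f;
  hnorm_cstar : forall (X Y : cstar_banach) (f : mor cstar_banach X Y),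
    hnorm (star cstar_star f ∘ f) = hnorm f ^+ 2;
  cstar_positive : forall (X Y : cstar_banach) (f : mor cstar_banach X Y),
    positive cstar_star (star cstar_star f ∘ f) }.

Record unitaryFusionCategory (R : realType) := UnitaryFusionCategory {
  ufc_cstar :> cstarCategory R;
  ufc_monoidal : monoidal ufc_cstar;
  ufc_fusion : fusion ufc_monoidal;
  ufc_assoc_unitary : forall X Y Z : ufc_cstar,
    unitary (cstar_star ufc_cstar) (assoc ufc_monoidal X Y Z);
  ufc_lunit_unitary : forall X : ufc_cstar,
    unitary (cstar_star ufc_cstar) (lunit ufc_monoidal X);
  ufc_runit_unitary : forall X : ufc_cstar,
    unitary (cstar_star ufc_cstar) (runit ufc_monoidal X);
  ufc_tens_star : forall (W X Y Z : ufc_cstar)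
    (f : mor ufc_cstar W X) (g : mor ufc_cstar Y Z),
    star (cstar_star ufc_cstar) (tensM ufc_monoidal f g) =
    tensM ufc_monoidal (star (cstar_star ufc_cstar) f)
                       (star (cstar_star ufc_cstar) g) }.

(* Main.v *)
Require Import Defs.
From mathcomp Require Import all_boot all_order all_algebra.
From mathcomp Require Import all_classical all_reals topology normedtype.
From mathcomp Require Import complex.

(** Write X ⊗ Y for the tensor product and fix a simple object X.  A braiding c
    gives a half braiding f_V = c_{X,V} : X ⊗ V -> V ⊗ X, natural in V, with
    f_{V ⊗ W} = (V ⊗ f_W)(f_V ⊗ W) up to associators, and g_V = (f_V^-1)^† is
    another one because taking inverse adjoints preserves these axioms.  The
    claim f_Y^† f_Y = 1 says that f_Y = g_Y.

    Let Y have a dual D and let r : 1 -> Y ⊗ D be a coevaluation scaled to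
    r^† r = 1.  Creating the pair (Y, D) to the right of X is an isometry
    w : X -> (X ⊗ Y) ⊗ D, and E(a) = w^† (a ⊗ D) w is a unital faithful
    positive map from End(X ⊗ Y) to End(X), which consists of scalars.  Put
    t = E(f_Y^† f_Y).  Three facts give the theorem.

    - Multiplicativity ([half_braiding_power]).  Since f_{V ⊗ Y} is
      (V ⊗ f_Y)(f_V ⊗ Y), creating pairs repeatedly gives isometries
      w_n : X -> (X ⊗ V_n) ⊗ Q_n at which f_{V_n} ⊗ Q_n has mean square t^n.
    - Boundedness ([half_braiding_hnorm_bound]).  The operators
      (f_V^† f_V) ⊗ U are hermitian and natural in V and U.  Their norms are
      bounded uniformly in V and U: naturality reduces high powers of such an
      operator to those of its values on the finitely many simple objects, up
      to a constant factor, and |b^(2^j)| = |b|^(2^j) for b hermitian, so the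
      constant disappears as j grows ([natural_hermitian_hnorm_le]).
      Hence the powers of t are bounded, and t <= 1.
    - Duality.  Likewise s = E(g_Y^† g_Y) <= 1.  Since f_Y^† g_Y = 1,
      E((f_Y - g_Y)^† (f_Y - g_Y)) = t + s - 2 <= 0; positivity makes this
      zero, and the zigzag identity for r makes E faithful, so f_Y = g_Y
      ([simple_half_braiding_unitary]).

    For an arbitrary X, the operator c_{X,Y}^† c_{X,Y} is natural in X and is
    the identity on each simple summand of X, hence is the identity. *)

Set Implicit Arguments.
Unset Strict Implicit.
Unset Printing Implicit Defensive.

Import Order.TTheory GRing.Theory Num.Theory.
Import numFieldNormedType.Exports.
Local Open Scope ring_scope.

(** * Linear categories and Schur's lemma *)

Section LinearCategory.
Variables (R : realType) (C : linCategory R).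
Implicit Types W X Y Z : C.

Lemma mcompA W X Y Z (h : mor C Y Z) (g : mor C X Y) (f : mor C W X) :
  h ∘ (g ∘ f) = h ∘ g ∘ f.
Proof. exact: (compA_ax (linCategoryP C)). Qed.

Lemma comp1m X Y (f : mor C X Y) : idm Y ∘ f = f.
Proof. exact: (comp1m_ax (linCategoryP C)). Qed.

Lemma compm1 X Y (f : mor C X Y) : f ∘ idm X = f.
Proof. exact: (compm1_ax (linCategoryP C)). Qed.

(** This and the next lemma rewrite an adjacent pair of factors inside a
    composite that is bracketed to the right. *)
Lemma comp_reassoc W X X' Y Z (g : mor C Y Z) (f : mor C X Y)
    (g' : mor C X' Z) (f' : mor C X X') (k : mor C W X) :
  g ∘ f = g' ∘ f' -> g ∘ (f ∘ k) = g' ∘ (f' ∘ k).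
Proof. by rewrite !mcompA => ->. Qed.

Lemma comp_cancel W X Y (g : mor C Y X) (f : mor C X Y) (k : mor C W X) :
  g ∘ f = idm X -> g ∘ (f ∘ k) = k.
Proof. by rewrite mcompA => ->; rewrite comp1m. Qed.

Lemma compDl X Y Z (g g' : mor C Y Z) (f : mor C X Y) :
  (g + g') ∘ f = g ∘ f + g' ∘ f.
Proof.
have := comp_linearl_ax (linCategoryP C) f 1 g g'.
by rewrite !scale1r.
Qed.

Lemma compDr X Y Z (g : mor C Y Z) (f f' : mor C X Y) :
  g ∘ (f + f') = g ∘ f + g ∘ f'.
Proof.
have := comp_linearr_ax (linCategoryP C) g 1 f f'.
by rewrite !scale1r.
Qed.

Lemma comp0m X Y Z (f : mor C X Y) : (0 : mor C Y Z) ∘ f = 0.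
Proof. by apply: (addrI ((0 : mor C Y Z) ∘ f)); rewrite -compDl !addr0. Qed.

Lemma compm0 X Y Z (g : mor C Y Z) : g ∘ (0 : mor C X Y) = 0.
Proof. by apply: (addrI (g ∘ (0 : mor C X Y))); rewrite -compDr !addr0. Qed.

Lemma compZl X Y Z a (g : mor C Y Z) (f : mor C X Y) :
  (a *: g) ∘ f = a *: (g ∘ f).
Proof.
have := comp_linearl_ax (linCategoryP C) f a g 0.
by rewrite comp0m !addr0.
Qed.

Lemma compZr X Y Z a (g : mor C Y Z) (f : mor C X Y) :
  g ∘ (a *: f) = a *: (g ∘ f).
Proof.
have := comp_linearr_ax (linCategoryP C) g a f 0.
by rewrite compm0 !addr0.
Qed.

Lemma compNl X Y Z (g : mor C Y Z) (f : mor C X Y) : (- g) ∘ f = - (g ∘ f).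
Proof. by rewrite -scaleN1r compZl scaleN1r. Qed.

Lemma compNr X Y Z (g : mor C Y Z) (f : mor C X Y) : g ∘ (- f) = - (g ∘ f).
Proof. by rewrite -scaleN1r compZr scaleN1r. Qed.

Lemma comp_sumr X Y Z n (g : mor C Y Z) (f : 'I_n -> mor C X Y) :
  g ∘ (\sum_(k < n) f k) = \sum_(k < n) (g ∘ f k).
Proof.
by elim/big_ind2: _ => [|? ? ? ? <- <-|//]; rewrite ?compm0 ?compDr.
Qed.

Lemma simple_idm_neq0 X : simple_object X -> idm X <> 0.
Proof.
move=> [nz _] e; apply: nz => Y; split=> f g.
  by rewrite -(compm1 f) -(compm1 g) e !compm0.
by rewrite -(comp1m f) -(comp1m g) e !comp0m.
Qed.

(** A kernel of a is a subobject of X, so it is zero or all of X; in the first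
    case a is mono, hence itself a subobject isomorphic to X. *)
Lemma simple_end_zero_or_iso X (a : mor C X X) :
  abelian C -> simple_object X -> a = 0 \/ is_iso a.
Proof.
move=> abC [nz sX]; have [K [k [ak kU]]] := abelian_ker abC a.
have km : mono k.
  move=> T g h e; have [u [_ uU]] := kU T (k ∘ g)
    ltac:(by rewrite mcompA ak comp0m).
  by rewrite -(uU g) // -(uU h).
case: (sX K k km) => [K0|[k' [_ kk']]]; last first.
  by left; rewrite -(compm1 a) -kk' mcompA ak comp0m.
have am : mono a.
  move=> T g h e; apply/eqP; rewrite -subr_eq0; apply/eqP.
  have [|u [<- _]] := kU T (g - h).
    by rewrite compDr compNr e subrr.
  by rewrite ((K0 T).2 u 0) compm0.
by case: (sX X a am) => [|?]; [move/nz|right].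
Qed.

Definition mpow X (a : mor C X X) n := iter n (fun b => a ∘ b) (idm X).

Definition mhorner X (a : mor C X X) (p : {poly R[i]}) :=
  \sum_(k < size p) p`_k *: mpow a k.

Lemma mhornerE X (a : mor C X X) (p : {poly R[i]}) n : (size p <= n)%N ->
  mhorner a p = \sum_(k < n) p`_k *: mpow a k.
Proof.
move=> le_pn; rewrite /mhorner (big_ord_widen n (fun k => p`_k *: mpow a k)) //.
rewrite big_mkcond; apply: eq_bigr => k _; case: ltnP => // le_pk.
by rewrite nth_default // scale0r.
Qed.

Lemma mhorner_mulXsubC X (a : mor C X X) (p : {poly R[i]}) l :
  mhorner a (('X - l%:P) * p) = (a - l *: idm X) ∘ mhorner a p.
Proof.
have le1 : (size (('X - l%:P) * p)%R <= (size p).+1)%N.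
  by apply: leq_trans (size_polyMleq _ _) _; rewrite size_XsubC.
rewrite (mhornerE _ le1) compDl compNl compZl comp1m.
rewrite {1}/mhorner comp_sumr (mhornerE (p := p) a (leqnSn _)).
under eq_bigr => k _ do rewrite mulrBl coefB coefCM coefXM scalerBl -scalerA.
rewrite sumrB scaler_sumr; congr (_ - _).
rewrite big_ord_recl /= scale0r add0r; apply: eq_bigr => k _.
by rewrite compZr.
Qed.

(** The coordinates of the n + 1 powers 1, a, ..., a^n in a spanning family of
    n endomorphisms are linearly dependent. *)
Lemma annihilating_poly X (a : mor C X X) : finite_dimensional_homs C ->
  exists2 p : {poly R[i]}, p != 0 & mhorner a p = 0.
Proof.
move=> fdC.
have [n [e eP]] := fdC X X.
have [A AP] := choice (fun k : 'I_n.+1 => eP (mpow a k)).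
pose M := \matrix_(k < n.+1, j < n) A k j.
have /rowV0Pn[v /sub_kermxP vM v0] : kermx M != 0.
  rewrite kermx_eq0 /row_free; apply/negP => /eqP rM.
  by have := rank_leq_col M; rewrite rM ltnn.
pose p := \poly_(k < n.+1) v 0 (inord k).
have pE (k : 'I_n.+1) : p`_k = v 0 k by rewrite coef_poly ltn_ord inord_val.
exists p.
  apply: contra v0 => /eqP p0; apply/eqP/rowP => k.
  by rewrite mxE -pE p0 coef0.
rewrite (mhornerE a (size_poly _ _ : (size p <= n.+1)%N)).
under eq_bigr => k _ do rewrite pE AP scaler_sumr.
rewrite exchange_big /= big1 // => j _.
under eq_bigr => k _ do rewrite scalerA.
rewrite -scaler_suml; have /rowP/(_ j) := vM; rewrite !mxE => vMj.
rewrite [X in X *: _](_ : _ = 0) ?scale0r // -[RHS]vMj.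
by apply: eq_bigr => k _; rewrite mxE.
Qed.

(** Otherwise every a - l is invertible, while some product of such factors is
    zero because an annihilating polynomial of a splits over the complex
    numbers. *)
Lemma schur X (a : mor C X X) :
  abelian C -> finite_dimensional_homs C -> simple_object X ->
  exists l, a = l *: idm X.
Proof.
move=> abC fdC sX; apply: contrapT => no.
have inv l : is_iso (a - l *: idm X).
  case: (simple_end_zero_or_iso (a - l *: idm X) abC sX) => // /eqP.
  by rewrite subr_eq0 => /eqP al; case: no; exists l.
have [p p0] := annihilating_poly a fdC.
have [r ->] := closed_field_poly_normal p.
have hornerZ c (q : {poly R[i]}) :
    c != 0 -> mhorner a (c *: q) = 0 -> mhorner a q = 0.
  move=> c0; rewrite /mhorner size_scale //.
  under eq_bigr => k _ do rewrite coefZ -scalerA.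
  by rewrite -scaler_sumr => /eqP; rewrite scaler_eq0 (negPf c0) => /eqP.
move/(hornerZ _ _ _)=> /(_ _); rewrite lead_coef_eq0 => /(_ p0) {hornerZ p p0}.
elim: r => [|l r IH].
  rewrite big_nil /mhorner size_poly1 big_ord1 coef1 scale1r /=.
  exact: simple_idm_neq0.
rewrite big_cons mhorner_mulXsubC => e; apply: IH.
have [b [ba _]] := inv l.
by rewrite -(comp1m (mhorner _ _)) -ba -mcompA e compm0.
Qed.

End LinearCategory.

(** * Monoidal categories, creation of dual pairs, half braidings *)

Section MonoidalCategory.
Variables (R : realType) (C : linCategory R) (M : monoidal C).
Implicit Types (D Q V W X Y Z : C).
Local Notation "X ⊗ Y" := (tensO M X Y).
Local Notation "f ⊠ g" := (tensM M f g).
Local Notation "𝟙" := (tunit M).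
Local Notation "X ◁ g" := (tensM M (idm X) g) (at level 39).
Local Notation "f ▷ X" := (tensM M f (idm X)) (at level 39).
Local Notation α := (assoc M).
Local Notation αV := (assocV M).
Let ax := monoidalP M.

Lemma assocK X Y Z : αV X Y Z ∘ α X Y Z = idm _.
Proof. exact: fwdK. Qed.

Lemma assocVK X Y Z : α X Y Z ∘ αV X Y Z = idm _.
Proof. exact: bwdK. Qed.

Lemma runitK X : runitV M X ∘ runit M X = idm _.
Proof. exact: fwdK. Qed.

Lemma runitVK X : runit M X ∘ runitV M X = idm _.
Proof. exact: bwdK. Qed.

Lemma whisker_comp_r X Y Z W (g : mor C Y Z) (f : mor C X Y) :
  (g ∘ f) ▷ W = (g ▷ W) ∘ (f ▷ W).
Proof. by rewrite -(tensM_comp ax) compm1. Qed.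

Lemma whisker_comp_l X Y Z W (g : mor C Y Z) (f : mor C X Y) :
  W ◁ (g ∘ f) = (W ◁ g) ∘ (W ◁ f).
Proof. by rewrite -(tensM_comp ax) compm1. Qed.

Lemma whisker_exchange X X' Y Y' (f : mor C X X') (g : mor C Y Y') :
  (f ▷ Y') ∘ (X ◁ g) = (X' ◁ g) ∘ (f ▷ Y).
Proof. by rewrite -!(tensM_comp ax) !compm1 !comp1m. Qed.

Lemma whiskerDr X Y W (f g : mor C X Y) : (f + g) ▷ W = f ▷ W + g ▷ W.
Proof. by have := tensM_linearl ax (idm W) 1 f g; rewrite !scale1r. Qed.

Lemma whiskerDl X Y W (f g : mor C X Y) : W ◁ (f + g) = W ◁ f + W ◁ g.
Proof. by have := tensM_linearr ax (idm W) 1 f g; rewrite !scale1r. Qed.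

Lemma whisker0r X Y W : (0 : mor C X Y) ▷ W = 0.
Proof. by apply: (addrI ((0 : mor C X Y) ▷ W)); rewrite -whiskerDr !addr0. Qed.

Lemma whisker0l X Y W : W ◁ (0 : mor C X Y) = 0.
Proof. by apply: (addrI (W ◁ (0 : mor C X Y))); rewrite -whiskerDl !addr0. Qed.

Lemma whisker_sum_r X Y W n (f : 'I_n -> mor C X Y) :
  (\sum_(k < n) f k) ▷ W = \sum_(k < n) (f k ▷ W).
Proof.
by elim/big_ind2: _ => [|? ? ? ? <- <-|//]; rewrite ?whisker0r ?whiskerDr.
Qed.

Lemma whiskerZr X Y W a (f : mor C X Y) : (a *: f) ▷ W = a *: (f ▷ W).
Proof. by have := tensM_linearl ax (idm W) a f 0; rewrite whisker0r !addr0. Qed.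

Lemma whiskerZl X Y W a (f : mor C X Y) : W ◁ (a *: f) = a *: (W ◁ f).
Proof. by have := tensM_linearr ax (idm W) a f 0; rewrite whisker0l !addr0. Qed.

Lemma whiskerBr X Y W (f g : mor C X Y) : (f - g) ▷ W = f ▷ W - g ▷ W.
Proof. by rewrite whiskerDr -(scaleN1r g) whiskerZr scaleN1r. Qed.

Lemma inverse_square X Y X' Y' (h : mor C X Y) (k : mor C Y X)
    (h' : mor C X' Y') (k' : mor C Y' X') (f : mor C X X') (g : mor C Y Y') :
  h ∘ k = idm Y -> k' ∘ h' = idm X' -> h' ∘ f = g ∘ h -> k' ∘ g = f ∘ k.
Proof.
move=> hk kh e; rewrite -[g]compm1 -hk [g ∘ _]mcompA -e -mcompA.
by rewrite comp_cancel.
Qed.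

Lemma assocV_natural X X' Y Y' Z Z'
    (f : mor C X X') (g : mor C Y Y') (h : mor C Z Z') :
  αV X' Y' Z' ∘ (f ⊠ (g ⊠ h)) = ((f ⊠ g) ⊠ h) ∘ αV X Y Z.
Proof.
exact: (inverse_square (assocVK _ _ _) (assocK _ _ _) (assoc_natural ax f g h)).
Qed.

Lemma runitV_natural X X' (f : mor C X X') :
  runitV M X' ∘ f = (f ▷ 𝟙) ∘ runitV M X.
Proof.
exact: (inverse_square (runitVK _) (runitK _) (runit_natural ax f)).
Qed.

Lemma whisker_unit_inj X Y (f g : mor C X Y) : f ▷ 𝟙 = g ▷ 𝟙 -> f = g.
Proof.
move=> e; rewrite -(compm1 f) -(compm1 g) -runitVK !mcompA.
by rewrite -!(runit_natural ax) e.
Qed.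

Lemma comp_left_cancel X Y Z (k : mor C Y X) (h : mor C X Y) (f g : mor C Z X) :
  k ∘ h = idm X -> h ∘ f = h ∘ g -> f = g.
Proof. by move=> kh e; rewrite -(comp1m f) -kh -mcompA e comp_cancel. Qed.

(** A classical consequence of the pentagon and the triangle (Kelly): tensored
    with the unit, the equation is the pentagon for X, Y, 1, 1 with both unit
    constraints expressed by the triangle. *)
Lemma runit_tensor X Y : (X ◁ runit M Y) ∘ α X Y 𝟙 = runit M (X ⊗ Y).
Proof.
apply: whisker_unit_inj; apply: (comp_left_cancel (assocK X Y 𝟙)).
rewrite whisker_comp_r mcompA (assoc_natural ax) -(triangle ax) -(triangle ax).
rewrite whisker_comp_l -!mcompA.
have pent := pentagon ax X Y 𝟙 𝟙; rewrite -!mcompA in pent; rewrite -pent.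
rewrite !mcompA; congr (_ ∘ _).
by rewrite -(tensM_id ax) (assoc_natural ax).
Qed.

Lemma runitV_tensor X Y : α X Y 𝟙 ∘ runitV M (X ⊗ Y) = X ◁ runitV M Y.
Proof.
rewrite -[LHS]comp1m -(tensM_id ax) -[in idm (Y ⊗ 𝟙)]runitK whisker_comp_l.
by rewrite -mcompA (mcompA (X ◁ runit M Y)) runit_tensor runitVK compm1.
Qed.

Lemma pentagonV W X Y Z :
  (αV W X Y ▷ Z) ∘ αV W (X ⊗ Y) Z ∘ (W ◁ αV X Y Z) =
  αV (W ⊗ X) Y Z ∘ αV W X (Y ⊗ Z).
Proof.
apply: (comp_left_cancel (assocK (W ⊗ X) Y Z)).
apply: (comp_left_cancel (assocK W X (Y ⊗ Z))).
rewrite [in RHS](comp_cancel _ (assocVK _ _ _)) assocVK.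
rewrite mcompA (pentagon ax) -!mcompA (mcompA (_ ▷ Z)).
rewrite -whisker_comp_r assocVK (tensM_id ax) comp1m.
by rewrite (comp_cancel _ (assocVK _ _ _)) -whisker_comp_l assocVK (tensM_id ax).
Qed.

(** Creation of the pair (Y, D) on the right of A. *)
Definition creation Y D (r : mor C 𝟙 (Y ⊗ D)) (A : C) : mor C A (A ⊗ Y ⊗ D) :=
  αV A Y D ∘ (A ◁ r) ∘ runitV M A.

Lemma creation_natural Y D (r : mor C 𝟙 (Y ⊗ D)) A B (f : mor C A B) :
  creation r B ∘ f = (f ▷ Y ▷ D) ∘ creation r A.
Proof.
rewrite /creation -!mcompA runitV_natural (mcompA (B ◁ r)) -whisker_exchange.
by rewrite -mcompA mcompA -(tensM_id ax Y D) assocV_natural -!mcompA.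
Qed.

(** B is a spectator: this is the pentagon together with the compatibility of
    the right unit constraint with B ⊗ A. *)
Lemma creation_tensor Y D (r : mor C 𝟙 (Y ⊗ D)) A B :
  creation r (B ⊗ A) = (αV B A Y ▷ D) ∘ αV B (A ⊗ Y) D ∘ (B ◁ creation r A).
Proof.
rewrite /creation !whisker_comp_l -runitV_tensor -!mcompA.
rewrite (mcompA (B ◁ (A ◁ r))) -(assoc_natural ax) (tensM_id ax).
by rewrite !mcompA pentagonV -(mcompA _ (αV _ _ _)) assocK compm1.
Qed.

(** Up to associators this is X tensored with the zigzag identity for Y. *)
Lemma creation_zigzag Y D (ev : mor C (D ⊗ Y) 𝟙) (coev : mor C 𝟙 (Y ⊗ D)) X :
  runit M Y ∘ (Y ◁ ev) ∘ α Y D Y ∘ (coev ▷ Y) ∘ lunitV M Y = idm Y ->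
  runit M (X ⊗ Y) ∘ ((X ⊗ Y) ◁ ev) ∘ α (X ⊗ Y) D Y ∘ (creation coev X ▷ Y) =
  idm (X ⊗ Y).
Proof.
move=> zig; rewrite /creation !whisker_comp_r.
have pent : α (X ⊗ Y) D Y ∘ (αV X Y D ▷ Y) =
    αV X Y (D ⊗ Y) ∘ ((X ◁ α Y D Y) ∘ α X (Y ⊗ D) Y).
  apply: (comp_left_cancel (assocK X Y (D ⊗ Y))).
  rewrite (comp_cancel _ (assocVK _ _ _)) mcompA (pentagon ax) -!mcompA.
  by rewrite -whisker_comp_r assocVK (tensM_id ax) compm1.
have tri : α X 𝟙 Y ∘ (runitV M X ▷ Y) = X ◁ lunitV M Y.
  rewrite -[LHS]comp1m -(tensM_id ax) -[in idm (𝟙 ⊗ Y)](fwdK (lunit_iso M Y)).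
  rewrite whisker_comp_l -mcompA (mcompA (X ◁ fwd _)) (triangle ax).
  by rewrite -whisker_comp_r runitVK (tensM_id ax) compm1.
rewrite -!mcompA (comp_reassoc _ pent) -!mcompA.
rewrite (comp_reassoc _ (assoc_natural ax _ _ _)) tri.
rewrite -(tensM_id ax X Y) (comp_reassoc _ (esym (assocV_natural _ _ _))).
rewrite -runit_tensor -!mcompA (comp_cancel _ (assocVK _ _ _)).
rewrite -!whisker_comp_l.
by move: zig; rewrite -!mcompA => ->.
Qed.

(** Annihilating the created D with the evaluation recovers p from
    (p ▷ D) ∘ creation coev X, by the zigzag identity. *)
Lemma creation_faithful Y D : is_left_dual M D Y ->
  exists coev : mor C 𝟙 (Y ⊗ D), forall X W (p : mor C (X ⊗ Y) W),
    (p ▷ D) ∘ creation coev X = 0 -> p = 0.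
Proof.
move=> [ev [coev [zig _]]]; exists coev => X W p e.
rewrite -(compm1 p) -(creation_zigzag X zig) !mcompA -(runit_natural ax).
rewrite -(mcompA (runit M W)) whisker_exchange mcompA -(mcompA _ (p ▷ _)).
rewrite -(tensM_id ax D Y) -(assoc_natural ax) -!mcompA -whisker_comp_r e.
by rewrite whisker0r !compm0.
Qed.

(** The axioms of an object of the Drinfeld center over X; inverses of the
    components are supplied separately. *)
Definition half_braiding X (f : forall V, mor C (X ⊗ V) (V ⊗ X)) : Prop :=
  (forall V W (g : mor C V W), f W ∘ (X ◁ g) = (g ▷ X) ∘ f V) /\
  (forall V W, α V W X ∘ f (V ⊗ W) ∘ α X V W =
               (V ◁ f W) ∘ α V X W ∘ (f V ▷ W)).

(** Given w, which has created Q and V on the right of X, the pair (Y, D) is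
    created between them, so that V and Y become adjacent. *)
Definition creation_step Y D (r : mor C 𝟙 (Y ⊗ D)) X V Q
    (w : mor C X (X ⊗ V ⊗ Q)) : mor C X (X ⊗ (V ⊗ Y) ⊗ (D ⊗ Q)) :=
  (α X V Y ▷ (D ⊗ Q)) ∘ α (X ⊗ V ⊗ Y) D Q ∘ (creation r (X ⊗ V) ▷ Q) ∘ w.

(** The hexagon splits f (V ⊗ Y) into f V followed by f Y.  The new pair does
    not interact with f V, which can therefore act before the creation; up to
    the associators in front, f Y then acts on the new pair alone.  This is the
    source of the multiplicativity of the mean squares. *)
Lemma half_braiding_creation_step Y D (r : mor C 𝟙 (Y ⊗ D)) X V Q
    (w : mor C X (X ⊗ V ⊗ Q)) f : half_braiding f ->
  (α V Y X ▷ (D ⊗ Q)) ∘ ((f (V ⊗ Y) ▷ (D ⊗ Q)) ∘ creation_step r w) =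
  α (V ⊗ (Y ⊗ X)) D Q ∘ (αV V (Y ⊗ X) D ▷ Q) ∘
  (((V ◁ ((f Y ▷ D) ∘ creation r X)) ▷ Q) ∘ ((f V ▷ Q) ∘ w)).
Proof.
move=> [_ hex]; rewrite /creation_step -!mcompA.
rewrite (mcompA (f _ ▷ _)) (mcompA (α V Y X ▷ _)) -!whisker_comp_r.
have hexVY := hex V Y; rewrite -!mcompA in hexVY; rewrite hexVY.
rewrite -(tensM_id ax D Q) (comp_reassoc _ (esym (assoc_natural ax _ _ _))).
congr (_ ∘ _); rewrite !mcompA; congr (_ ∘ w).
rewrite -!whisker_comp_r; congr (_ ▷ Q).
rewrite -!mcompA !whisker_comp_r -!mcompA -creation_natural creation_tensor.
rewrite !whisker_comp_l -!mcompA (mcompA (α V X Y ▷ D)) -whisker_comp_r assocVK.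
rewrite (tensM_id ax) comp1m !mcompA; congr (_ ∘ _ ∘ _).
by rewrite -assocV_natural.
Qed.

End MonoidalCategory.

(** * Norms of natural hermitian families *)

Lemma bernoulli_ineq (R : realType) (e : R) n : 0 <= e ->
  1 + n%:R * e <= (1 + e) ^+ n.
Proof.
move=> e0; elim: n => [|n IH]; first by rewrite mul0r addr0 expr0.
rewrite exprS; apply: (le_trans _ (ler_wpM2l _ IH)); last by rewrite addr_ge0.
rewrite mulrDl mul1r mulrDr mulr1 -natr1 mulrDl mul1r.
by rewrite -!addrA lerD2l lerD2l lerDl mulr_ge0 // mulr_ge0.
Qed.

(** If y < x then (x / y)^(2^j) is unbounded in j, so a constant factor c
    cannot compensate for it. *)
Lemma le_of_pow2_le_real (R : realType) (x y c : R) : 0 <= x -> 0 <= y ->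
  (forall j, x ^+ (2 ^ j) <= c * y ^+ (2 ^ j)) -> x <= y.
Proof.
move=> x0 y0 H; rewrite leNgt; apply/negP => yx.
have [y_eq0|yN0] := eqVneq y 0.
  by have := H 0; rewrite y_eq0 !expr1 mulr0 leNgt -y_eq0 yx.
have yp : 0 < y by rewrite lt_def yN0.
pose e := x / y - 1.
have e0 : 0 < e by rewrite subr_gt0 ltr_pdivlMr // mul1r.
have lec j : 1 + (2 ^ j)%:R * e <= c.
  apply: le_trans (bernoulli_ineq _ (ltW e0)) _.
  by rewrite addrC subrK expr_div_n ler_pdivrMr ?exprn_gt0.
have c0 : 0 <= c by apply: le_trans (lec 0); rewrite addr_ge0 // mulr_ge0 // ltW.
have /archi_boundP := divr_ge0 c0 (ltW e0); set j := Num.bound _ => cj.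
have := lec j; rewrite leNgt => /negP; apply.
apply: (@lt_trans _ _ (j%:R * e)); first by rewrite -ltr_pdivrMr.
apply: (@le_lt_trans _ _ ((2 ^ j)%:R * e)); last by rewrite ltrDr ltr01.
by rewrite ler_pM2r // ler_nat ltnW // ltn_expl.
Qed.

Lemma le_of_pow2_le (R : realType) (x y c : R[i]) : 0 <= x -> 0 <= y -> 0 <= c ->
  (forall j, x ^+ (2 ^ j) <= c * y ^+ (2 ^ j)) -> x <= y.
Proof.
move=> x_ge0 y_ge0 /ger0_real/complex_realP[d ->].
have /complex_realP[a ea] := ger0_real x_ge0.
have /complex_realP[b eb] := ger0_real y_ge0.
move: x_ge0 y_ge0; rewrite {x}ea {y}eb !ler0c lecR => a0 b0 H.
apply: (@le_of_pow2_le_real _ a b d) => // j.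
by have := H j; rewrite -!rmorphXn -rmorphM lecR.
Qed.

Section CstarNorm.
Variables (R : realType) (C : cstarCategory R).
Implicit Types X Y Z V : C.
Local Notation "f ^†" := (star (cstar_star C) f).

Lemma hnorm_ge0 X Y (f : mor C X Y) : 0 <= hnorm f.
Proof. exact: normr_ge0. Qed.

Lemma hnormZ X Y a (f : mor C X Y) : hnorm (a *: f) = `|a| * hnorm f.
Proof. exact: (@normrZ _ (bhom C X Y)). Qed.

Lemma hnorm0 X Y : hnorm (0 : mor C X Y) = 0.
Proof. exact: (@normr0 _ (bhom C X Y)). Qed.

Lemma hnorm_eq0 X Y (f : mor C X Y) : hnorm f = 0 -> f = 0.
Proof. exact: (@normr0_eq0 _ (bhom C X Y)). Qed.

Lemma hnorm_sum X Y n (f : 'I_n -> mor C X Y) :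
  hnorm (\sum_(k < n) f k) <= \sum_(k < n) hnorm (f k).
Proof. exact: (@ler_norm_sum _ (bhom C X Y)). Qed.

Lemma star_self_eq0 X Y (f : mor C X Y) : f^† ∘ f = 0 -> f = 0.
Proof.
move=> e; apply: hnorm_eq0; apply/eqP; rewrite -(sqrf_eq0 (hnorm f)).
by rewrite -hnorm_cstar e hnorm0.
Qed.

Record additive_endofunctor := AdditiveEndofunctor {
  fobj :> C -> C;
  fmap : forall X Y, mor C X Y -> mor C (fobj X) (fobj Y);
  fmap_id : forall X, fmap (idm X) = idm (fobj X);
  fmap_comp : forall X Y Z (g : mor C Y Z) (f : mor C X Y),
    fmap (g ∘ f) = fmap g ∘ fmap f;
  fmapD : forall X Y (f g : mor C X Y), fmap (f + g) = fmap f + fmap g }.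

Arguments fmap F {X Y} f : rename.

Lemma fmap0 (F : additive_endofunctor) X Y : fmap F (0 : mor C X Y) = 0.
Proof. by apply: (addrI (fmap F 0)); rewrite -fmapD !addr0. Qed.

Lemma fmap_sum (F : additive_endofunctor) X Y n (f : 'I_n -> mor C X Y) :
  fmap F (\sum_(k < n) f k) = \sum_(k < n) fmap F (f k).
Proof. by elim/big_ind2: _ => [|? ? ? ? <- <-|//]; rewrite ?fmap0 ?fmapD. Qed.

Definition msquare X (a : mor C X X) := a ∘ a.

(** Iterated squaring keeps an operator hermitian, so the C*-identity applies
    at each step. *)
Lemma hnorm_iter_msquare X (a : mor C X X) j : a^† = a ->
  hnorm (iter j (@msquare X) a) = hnorm a ^+ (2 ^ j).
Proof.
move=> ha; suff [] : hnorm (iter j (@msquare X) a) = hnorm a ^+ (2 ^ j) /\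
  (iter j (@msquare X) a)^† = iter j (@msquare X) a by [].
elim: j => [|j [IHn IHs]] //=; split; last by rewrite star_comp !IHs.
by rewrite /msquare -{1}IHs hnorm_cstar IHn -exprM expnSr.
Qed.

(** The decomposition of V into simple objects need not be orthogonal, so it
    bounds b V only up to a constant depending on V.  By naturality the same
    constant serves for all the powers (b V)^(2^j), whose norm is the power of
    the norm; the comparison as j grows removes the constant. *)
Lemma natural_hermitian_hnorm_le (F : additive_endofunctor)
    (b : forall V, mor C (F V) (F V)) n (T : 'I_n -> C) :
  semisimple C -> (forall X, simple_object X -> exists k, isomorphic X (T k)) ->
  (forall V W (g : mor C V W), b W ∘ fmap F g = fmap F g ∘ b V) ->
  (forall V, (b V)^† = b V) ->
  forall V, hnorm (b V) <= \sum_(k < n) hnorm (b (T k)).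
Proof.
move=> ss repT nat herm V.
pose bj j V := iter j (@msquare (F V)) (b V).
have natj j X Y (g : mor C X Y) : bj j Y ∘ fmap F g = fmap F g ∘ bj j X.
  elim: j => [|j IH]; first exact: nat.
  have bjS Z : bj j.+1 Z = bj j Z ∘ bj j Z by [].
  by rewrite !bjS -mcompA IH !mcompA IH.
have [m [S [simS [inj [proj [_ _ sumV]]]]]] := ss V.
set K := \sum_(k < n) _.
have /choice[c cP] (k : 'I_m) : exists c : R[i], 0 <= c /\
    forall j, hnorm (bj j V ∘ fmap F (inj k ∘ proj k)) <= c * K ^+ (2 ^ j).
  have [l [u [v [vu _]]]] := repT _ (simS k).
  exists (hnorm (fmap F (inj k ∘ v)) * hnorm (fmap F (u ∘ proj k))).
  split=> [|j]; first by rewrite mulr_ge0 ?hnorm_ge0.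
  have -> : inj k ∘ proj k = (inj k ∘ v) ∘ (u ∘ proj k).
    by rewrite -mcompA (mcompA v) vu comp1m.
  rewrite fmap_comp mcompA natj -mcompA -mulrA.
  apply: (le_trans (hnorm_comp _ _)); rewrite ler_wpM2l ?hnorm_ge0 //.
  apply: (le_trans (hnorm_comp _ _)); rewrite mulrC ler_wpM2l ?hnorm_ge0 //.
  rewrite hnorm_iter_msquare // lerXn2r ?nnegrE ?sumr_ge0 ?hnorm_ge0 //.
    by move=> i _; exact: hnorm_ge0.
  rewrite /K (bigD1 l) //= lerDl.
  by apply: sumr_ge0 => i _; exact: hnorm_ge0.
have K0 : 0 <= K by apply: sumr_ge0 => k _; exact: hnorm_ge0.
apply: (@le_of_pow2_le _ _ _ (\sum_(k < m) c k)); rewrite ?hnorm_ge0 //.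
  by apply: sumr_ge0 => k _; have [] := cP k.
move=> j; rewrite -hnorm_iter_msquare // -/(bj j V).
rewrite -[bj j V]compm1 -fmap_id -sumV fmap_sum comp_sumr mulr_suml.
apply: (le_trans (hnorm_sum _)); apply: ler_sum => k _.
by have [_] := cP k; apply.
Qed.

End CstarNorm.

(** * Half braidings of unitary fusion categories *)

Section UnitaryFusion.
Variables (R : realType) (C : unitaryFusionCategory R).
Implicit Types D Q U V W X Y Z : C.
Local Notation M := (ufc_monoidal C).
Local Notation "X ⊗ Y" := (tensO M X Y).
Local Notation "𝟙" := (tunit M).
Local Notation "X ◁ g" := (tensM M (idm X) g) (at level 39).
Local Notation "f ▷ X" := (tensM M f (idm X)) (at level 39).
Local Notation α := (assoc M).
Local Notation αV := (assocV M).
Local Notation "f ^†" := (star (cstar_star C) f).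
Let ax := monoidalP M.

Lemma starD X Y (f g : mor C X Y) : (f + g)^† = f^† + g^†.
Proof.
by have := star_antilinear (cstar_star C) 1 f g; rewrite rmorph1 !scale1r.
Qed.

Lemma star0 X Y : (0 : mor C X Y)^† = 0.
Proof. by apply: (addrI ((0 : mor C X Y)^†)); rewrite -starD !addr0. Qed.

Lemma starZ X Y a (f : mor C X Y) : (a *: f)^† = a^* *: f^†.
Proof.
by have := star_antilinear (cstar_star C) a f 0; rewrite star0 !addr0.
Qed.

Lemma starB X Y (f g : mor C X Y) : (f - g)^† = f^† - g^†.
Proof. by rewrite starD -scaleN1r starZ rmorphN1 scaleN1r. Qed.

Lemma star_whisker_r X Y W (f : mor C X Y) : (f ▷ W)^† = f^† ▷ W.
Proof. by rewrite ufc_tens_star star_id. Qed.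

Lemma star_whisker_l X Y W (f : mor C X Y) : (W ◁ f)^† = W ◁ f^†.
Proof. by rewrite ufc_tens_star star_id. Qed.

Lemma unitary_star X Y (u : mor C X Y) (v : mor C Y X) :
  unitary (cstar_star C) u -> u ∘ v = idm Y -> u^† = v.
Proof. by move=> [_ uu] uv; rewrite -[LHS]compm1 -uv mcompA uu comp1m. Qed.

Lemma star_assoc X Y Z : (α X Y Z)^† = αV X Y Z.
Proof. exact: unitary_star (ufc_assoc_unitary _ _ _) (assocVK _ _ _ _). Qed.

Lemma star_assocV X Y Z : (αV X Y Z)^† = α X Y Z.
Proof. by rewrite -star_assoc starK. Qed.

Lemma star_runitV X : (runitV M X)^† = runit M X.
Proof.
by rewrite -(unitary_star (ufc_runit_unitary X) (runitVK _ _)) starK.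
Qed.

Definition isometry X Y (f : mor C X Y) : Prop := f^† ∘ f = idm X.

Lemma isometry_comp X Y Z (g : mor C Y Z) (f : mor C X Y) :
  isometry g -> isometry f -> isometry (g ∘ f).
Proof.
rewrite /isometry => gg ff.
by rewrite star_comp -mcompA (mcompA g^†) gg comp1m.
Qed.

Lemma isometry_whisker_r X Y W (f : mor C X Y) :
  isometry f -> isometry (f ▷ W).
Proof.
by rewrite /isometry => ff; rewrite star_whisker_r -whisker_comp_r ff (tensM_id ax).
Qed.

Lemma isometry_whisker_l X Y W (f : mor C X Y) :
  isometry f -> isometry (W ◁ f).
Proof.
by rewrite /isometry => ff; rewrite star_whisker_l -whisker_comp_l ff (tensM_id ax).
Qed.

Lemma isometry_assoc X Y Z : isometry (α X Y Z).
Proof. by rewrite /isometry star_assoc assocK. Qed.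

Lemma isometry_assocV X Y Z : isometry (αV X Y Z).
Proof. by rewrite /isometry star_assocV assocVK. Qed.

Lemma isometry_runitV X : isometry (runitV M X).
Proof. by rewrite /isometry star_runitV runitVK. Qed.

Lemma gram_isometry X Y Z (u : mor C Y Z) (f g : mor C X Y) :
  isometry u -> (u ∘ f)^† ∘ (u ∘ g) = f^† ∘ g.
Proof.
rewrite /isometry => uu.
by rewrite star_comp -mcompA (mcompA u^†) uu comp1m.
Qed.

Lemma isometry_creation Y D (r : mor C 𝟙 (Y ⊗ D)) X :
  isometry r -> isometry (creation r X).
Proof.
move=> rr; apply: isometry_comp (isometry_runitV _).
by apply: isometry_comp (isometry_assocV _ _ _) (isometry_whisker_l _ rr).
Qed.

Lemma isometry_creation_step Y D (r : mor C 𝟙 (Y ⊗ D)) X V Q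
    (w : mor C X (X ⊗ V ⊗ Q)) :
  isometry r -> isometry w -> isometry (creation_step r w).
Proof.
move=> rr ww; apply: isometry_comp ww; apply: isometry_comp; last first.
  exact/isometry_whisker_r/isometry_creation.
apply: isometry_comp (isometry_assoc _ _ _).
exact/isometry_whisker_r/isometry_assoc.
Qed.

Lemma gram_creation_step Y D (r : mor C 𝟙 (Y ⊗ D)) X V Q
    (w : mor C X (X ⊗ V ⊗ Q)) f t s : half_braiding (M := M) f ->
  ((f Y ▷ D) ∘ creation r X)^† ∘ ((f Y ▷ D) ∘ creation r X) = t *: idm X ->
  ((f V ▷ Q) ∘ w)^† ∘ ((f V ▷ Q) ∘ w) = s *: idm X ->
  ((f (V ⊗ Y) ▷ (D ⊗ Q)) ∘ creation_step r w)^† ∘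
    ((f (V ⊗ Y) ▷ (D ⊗ Q)) ∘ creation_step r w) = (t * s) *: idm X.
Proof.
move=> hf; set q := (f Y ▷ D) ∘ _; set k := (f V ▷ Q) ∘ w => qt ks.
rewrite -(gram_isometry _ _ (isometry_whisker_r (D ⊗ Q) (isometry_assoc V Y X))).
rewrite (half_braiding_creation_step r w hf) -/q -/k gram_isometry; last first.
  apply: isometry_comp (isometry_assoc _ _ _) _.
  exact/isometry_whisker_r/isometry_assocV.
rewrite star_comp star_whisker_r star_whisker_l -mcompA (mcompA (_ ▷ Q)).
rewrite -whisker_comp_r -whisker_comp_l qt whiskerZl whiskerZr !(tensM_id ax).
by rewrite compZl comp1m compZr ks scalerA.
Qed.

(** The exponent starts at 1, where the pair is (Y, D) itself. *)
Lemma half_braiding_power Y D (r : mor C 𝟙 (Y ⊗ D)) X f t n :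
  half_braiding (M := M) f -> isometry r ->
  ((f Y ▷ D) ∘ creation r X)^† ∘ ((f Y ▷ D) ∘ creation r X) = t *: idm X ->
  exists V Q (w : mor C X (X ⊗ V ⊗ Q)), isometry w /\
    ((f V ▷ Q) ∘ w)^† ∘ ((f V ▷ Q) ∘ w) = t ^+ n.+1 *: idm X.
Proof.
move=> hf rr ft; elim: n => [|n [V [Q [w [ww IH]]]]].
  by exists Y, D, (creation r X); split; [exact: isometry_creation|rewrite expr1].
exists (V ⊗ Y), (D ⊗ Q), (creation_step r w); split.
  exact: isometry_creation_step.
by rewrite exprS; exact: gram_creation_step.
Qed.

Definition whisker_functor_l Z : additive_endofunctor C.
Proof.
exists (fun U => Z ⊗ U) (fun U V g => Z ◁ g).
- by move=> U; exact: tensM_id ax _ _.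
- by move=> U V W g f; exact: whisker_comp_l.
- by move=> U V f g; exact: whiskerDl.
Defined.

Definition whisker_functor_lr X U : additive_endofunctor C.
Proof.
exists (fun V => X ⊗ V ⊗ U) (fun V W g => (X ◁ g) ▷ U).
- by move=> V; rewrite !(tensM_id ax).
- by move=> V W Z g f; rewrite whisker_comp_l whisker_comp_r.
- by move=> V W f g; rewrite whiskerDl whiskerDr.
Defined.

(** The family is natural in each of V and U, so the bound for natural hermitian
    families reduces first U and then V to the simple representatives. *)
Lemma half_braiding_hnorm_bound X f : half_braiding (M := M) (X := X) f ->
  exists K, forall V U, hnorm (((f V)^† ∘ f V) ▷ U) <= K.
Proof.
move=> [nat _].
have [n [T repT]] := fusion_simples (ufc_fusion C).
have ss := fusion_semisimple (ufc_fusion C).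
pose h V := (f V)^† ∘ f V.
have hnat V W (g : mor C V W) : h W ∘ (X ◁ g) = (X ◁ g) ∘ h V.
  rewrite /h -mcompA nat !mcompA; congr (_ ∘ _).
  have := congr1 (star (cstar_star C)) (nat _ _ g^†).
  by rewrite !star_comp star_whisker_l star_whisker_r starK.
have hherm V : (h V)^† = h V by rewrite star_comp starK.
exists (\sum_(l < n) \sum_(k < n) hnorm (h (T k) ▷ T l)) => V U.
have bnd := @natural_hermitian_hnorm_le _ _ (whisker_functor_l (X ⊗ V))
  (fun U => h V ▷ U) n T ss repT.
apply: le_trans (bnd _ _ U) _.
- by move=> ? ? g; exact: whisker_exchange.
- by move=> ?; rewrite star_whisker_r hherm.
apply: ler_sum => l _.
apply: (@natural_hermitian_hnorm_le _ _ (whisker_functor_lr X (T l))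
  (fun V => h V ▷ T l) n T ss repT).
- by move=> ? ? g; rewrite -!whisker_comp_r hnat.
- by move=> ?; rewrite star_whisker_r hherm.
Qed.

(** The scalar t belongs to the spectrum of q^† q. *)
Lemma gram_scalar_ge0 X Y (q : mor C X Y) t : idm X <> 0 ->
  q^† ∘ q = t *: idm X -> 0 <= t.
Proof.
move=> X0 qt; have [_] := cstar_positive q; rewrite qt; apply.
move=> [b [_ e]]; apply: X0; rewrite -e -scalerBl.
by rewrite subrr scale0r comp0m.
Qed.

(** The powers of t are mean squares of the bounded family (f V ▷ Q) at
    isometries, hence are bounded. *)
Lemma half_braiding_mean_le1 Y D (r : mor C 𝟙 (Y ⊗ D)) X f t :
  idm X <> 0 -> half_braiding (M := M) f -> isometry r ->
  ((f Y ▷ D) ∘ creation r X)^† ∘ ((f Y ▷ D) ∘ creation r X) = t *: idm X ->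
  t <= 1.
Proof.
move=> X0 hf rr ft; have t0 := gram_scalar_ge0 X0 ft.
have [K KP] := half_braiding_hnorm_bound hf.
have K0 : 0 <= K by apply: le_trans (KP X X); exact: hnorm_ge0.
have N0 : 0 < hnorm (idm X).
  rewrite lt_def hnorm_ge0 andbT; apply/eqP => e.
  by apply: X0; exact: hnorm_eq0 e.
apply: (@le_of_pow2_le _ _ _ K) => // j; rewrite expr1n mulr1.
have [V [Q [w [ww wt]]]] := half_braiding_power (2 ^ j).-1 hf rr ft.
move: wt; rewrite prednK ?expn_gt0 // => wt.
rewrite -(ler_pM2r N0) -[t ^+ _]ger0_norm ?exprn_ge0 // -hnormZ -wt hnorm_cstar.
apply: (@le_trans _ _ ((hnorm (f V ▷ Q) * hnorm w) ^+ 2)).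
  by rewrite lerXn2r ?nnegrE ?mulr_ge0 ?hnorm_ge0 // hnorm_comp.
rewrite exprMn -!hnorm_cstar ww star_whisker_r -whisker_comp_r.
by rewrite ler_wpM2r ?hnorm_ge0.
Qed.

(** By Schur's lemma coev^† coev is a scalar s >= 0.  If s > 0 it can
    be rescaled to an isometry; if s = 0 then coev = 0, and faithfulness forces
    all morphisms out of X ⊗ Y to vanish. *)
Lemma isometric_dual Y :
  (exists D (r : mor C 𝟙 (Y ⊗ D)), isometry r /\
     forall X W (p : mor C (X ⊗ Y) W), (p ▷ D) ∘ creation r X = 0 -> p = 0) \/
  (forall X W (p : mor C (X ⊗ Y) W), p = 0).
Proof.
have [[D dual] _] := fusion_rigid (ufc_fusion C) Y.
have [coev faith] := creation_faithful dual.
have fusC := ufc_fusion C; have unit_simple := fusion_unit fusC.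
have [s sE] := schur (coev^† ∘ coev) (fusion_abelian fusC) (fusion_homs fusC)
  unit_simple.
have s0 := gram_scalar_ge0 (simple_idm_neq0 unit_simple) sE.
have [sZ|sN0] := eqVneq s 0.
  right=> X W p; apply: faith; rewrite /creation (star_self_eq0 (f := coev)).
    by rewrite whisker0l compm0 comp0m compm0.
  by rewrite sE sZ scale0r.
left; exists D, ((sqrtC s)^-1 *: coev); split.
  rewrite /isometry starZ compZl compZr sE !scalerA.
  rewrite -normCKC normfV ger0_norm ?sqrtC_ge0 // exprVn sqrtCK mulVf //.
  exact: scale1r.
move=> X W p; rewrite /creation whiskerZl compZr compZl compZr => /eqP.
rewrite scaler_eq0 invr_eq0 sqrtC_eq0 (negPf sN0) => /eqP.
exact: faith.
Qed.

(** Inversion and the adjoint both reverse the order of composites, and both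
    exchange the unitary associators with their inverses, so doing both
    preserves the half braiding axioms. *)
Lemma half_braiding_inverse_star X (f : forall V, mor C (X ⊗ V) (V ⊗ X))
    (fV : forall V, mor C (V ⊗ X) (X ⊗ V)) :
  half_braiding (M := M) f ->
  (forall V, fV V ∘ f V = idm _) -> (forall V, f V ∘ fV V = idm _) ->
  half_braiding (M := M) (fun V => (fV V)^†).
Proof.
move=> [nat hex] fVK fK; split=> [V W g|V W].
  have e := inverse_square (fK W) (fVK V) (nat W V g^†).
  have := congr1 (star (cstar_star C)) e.
  by rewrite !star_comp star_whisker_l star_whisker_r !starK => ->.
have e : (fV V ▷ W) ∘ (αV V X W ∘ (V ◁ fV W)) =
    αV X V W ∘ (fV (V ⊗ W) ∘ αV V W X).
  have c1 : (fV V ▷ W) ∘ (f V ▷ W) = idm _.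
    by rewrite -whisker_comp_r fVK (tensM_id ax).
  have c2 : (V ◁ fV W) ∘ (V ◁ f W) = idm _.
    by rewrite -whisker_comp_l fVK (tensM_id ax).
  have c3 : (V ◁ f W) ∘ (V ◁ fV W) = idm _.
    by rewrite -whisker_comp_l fK (tensM_id ax).
  have c4 : (f V ▷ W) ∘ (fV V ▷ W) = idm _.
    by rewrite -whisker_comp_r fK (tensM_id ax).
  apply: (comp_left_cancel c1); rewrite (comp_cancel _ c4).
  apply: (comp_left_cancel (assocK _ V X W)).
  rewrite (comp_cancel _ (assocVK _ _ _ _)).
  apply: (comp_left_cancel c2); rewrite c3.
  have hexVW := hex V W; rewrite -!mcompA in hexVW.
  rewrite (mcompA (α V X W)) mcompA -hexVW -!mcompA.
  rewrite (comp_cancel _ (assocVK _ _ _ _)).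
  by rewrite (comp_cancel _ (fK _)) assocVK.
have := congr1 (star (cstar_star C)) e.
rewrite !star_comp star_whisker_l star_whisker_r !star_assocV => <-.
by [].
Qed.

(** With g = (f^-1)^†, the vectors F and G below are f and g applied to the
    created pair: they have mean squares at most 1 and inner product 1, which
    is the equality case of Cauchy-Schwarz. *)
Lemma simple_half_braiding_unitary X (f : forall V, mor C (X ⊗ V) (V ⊗ X))
    (fV : forall V, mor C (V ⊗ X) (X ⊗ V)) Y :
  simple_object X -> half_braiding (M := M) f ->
  (forall V, fV V ∘ f V = idm _) -> (forall V, f V ∘ fV V = idm _) ->
  f Y = (fV Y)^†.
Proof.
move=> simX hf fVK fK.
have hg := half_braiding_inverse_star hf fVK fK; set g := fun V => _ in hg.
have X0 := simple_idm_neq0 simX; have fusC := ufc_fusion C.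
apply/eqP; rewrite -subr_eq0; apply/eqP; rewrite -/(g Y).
have [[D [r [rr faith]]]|zero] := isometric_dual Y; last exact: zero.
pose F := (f Y ▷ D) ∘ creation r X; pose G := (g Y ▷ D) ∘ creation r X.
have scal a := schur (X := X) a (fusion_abelian fusC) (fusion_homs fusC) simX.
have [t tE] := scal (F^† ∘ F); have [s sE] := scal (G^† ∘ G).
have t1 := half_braiding_mean_le1 X0 hf rr tE.
have s1 := half_braiding_mean_le1 X0 hg rr sE.
have FG : F^† ∘ G = idm X.
  rewrite star_comp -mcompA (mcompA _ (g Y ▷ D)) star_whisker_r -whisker_comp_r.
  rewrite -star_comp fVK star_id (tensM_id ax) comp1m.
  exact: isometry_creation.
have GF : G^† ∘ F = idm X by
  rewrite -(starK (cstar_star C) F) -star_comp FG star_id.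
have FBG : (F - G)^† ∘ (F - G) = (t + s - 2) *: idm X.
  rewrite starB compDl compNl !compDr !compNr tE sE FG GF.
  rewrite scalerBl scalerDl scaler_nat mulr2n opprB opprD !addrA.
  by rewrite [in RHS]addrAC -!addrA; congr (_ + _); rewrite addrCA.
apply: faith; rewrite whiskerBr compDl compNl -/F -/G.
apply: star_self_eq0; rewrite FBG.
have : t + s - 2 == 0.
  rewrite eq_le (gram_scalar_ge0 X0 FBG) andbT subr_le0.
  by rewrite -[2]/(1 + 1) lerD.
by move/eqP->; rewrite scale0r.
Qed.

End UnitaryFusion.

(** * Unitarity of braidings *)

Theorem theorem3p2 (R : realType) (C : unitaryFusionCategory R)
    (c : braiding (ufc_monoidal C)) (X Y : C) :
  unitary (cstar_star C) (braid c X Y).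
Proof.
set M := ufc_monoidal C.
have ax := monoidalP M.
pose cV X Y := bwd (braid_iso c X Y).
have cVK V W : cV V W ∘ braid c V W = idm _ by exact: fwdK.
have cK V W : braid c V W ∘ cV V W = idm _ by exact: bwdK.
pose h V := star (cstar_star C) (braid c V Y) ∘ braid c V Y.
have half V : half_braiding (M := M) (fun W => braid c V W).
  split=> [W W' g|W W']; first exact: braid_natural.
  exact: braid_hexagon1.
have simple_h V : simple_object V -> h V = idm _.
  move=> sV; rewrite /h (simple_half_braiding_unitary Y sV (half V) (cVK V) (cK V)).
  by rewrite starK -(simple_half_braiding_unitary Y sV (half V) (cVK V) (cK V)) cVK.
have natural_h V W (g : mor C V W) :
    h W ∘ tensM M g (idm Y) = tensM M g (idm Y) ∘ h V.
  rewrite /h -mcompA braid_natural !mcompA; congr (_ ∘ _).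
  have := congr1 (star (cstar_star C))
    (braid_natural c (star (cstar_star C) g) (idm Y)).
  by rewrite !star_comp !ufc_tens_star !star_id starK.
have hX : h X = idm _.
  have [n [S [simS [inj [proj [_ _ sumX]]]]]] := fusion_semisimple (ufc_fusion C) X.
  rewrite -[LHS]compm1 -(tensM_id ax) -sumX whisker_sum_r comp_sumr.
  apply: eq_bigr => k _; rewrite whisker_comp_r mcompA natural_h simple_h //.
  by rewrite compm1.
have cVE : star (cstar_star C) (braid c X Y) = cV X Y.
  by rewrite -[LHS]compm1 -(cK X Y) mcompA -/(h X) hX comp1m.
by split; rewrite cVE.
Qed.
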